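(* Let $\mathbb K$ be a field, let $M$ be a finitely generated, commutative, torsion-free and cancellative binoid, and let $i:\operatorname{Spec}M\to\operatorname{Spec}\mathbb K[M]$, $\mathfrak p\mapsto\mathbb K[\mathfrak p]$. For any sheaf of abelian groups $\mathscr F$ on $\operatorname{Spec}M$, the Zariski cohomology of the pushforward vanishes: $$\mathrm H^j(\operatorname{Spec}\mathbb K[M],i_*\mathscr F)=0\quad\text{for all }j\ge1.$$
   Context: A binoid $(M,+,0,\infty)$ is a commutative monoid with an absorbing element $\infty$. $M$ is cancellative if $a+x=a+y\neq\infty$ implies $x=y$; torsion-free if $nx=ny\ne\infty$ for some $n\ge1$ implies $x=y$. An ideal is a subset $I\ni\infty$ with $M+I\subseteq I$; it is prime if $I\ne M$ and $a+b\in I$ implies $a\in I$ or $b\in I$. $\operatorname{Spec}M$ is the set of prime ideals with the (Zariski) topology having basis $D(f)=\{\mathfrak p\mid f\notin\mathfrak p\}$, $f\in M$. $\mathbb K[M]$ is the $\mathbb K$-algebra with $\mathbb K$-basis $T^\mu$, $\mu\in M\setminus\{\infty\}$, multiplication $T^\mu T^\nu=T^{\mu+\nu}$, and $T^\infty=0$. For an ideal $I\subseteq M$, $\mathbb K[I]$ is the ideal of $\mathbb K[M]$ spanned by $T^\mu$, $\mu\in I$. Under these hypotheses $\mathbb K[\mathfrak p]$ is prime whenever $\mathfrak p$ is, and $i$ is continuous for the Zariski topologies. *)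

(* Defs.v *)
From HB Require Import structures.
From mathcomp Require Import all_boot all_algebra finmap.
From mathcomp Require Import boolp classical_sets topology.
From mathcomp.multinomials Require Import monalg.

Set Implicit Arguments.
Unset Strict Implicit.
Unset Printing Implicit Defensive.

Import GRing.Theory.

Local Open Scope classical_set_scope.
Local Open Scope ring_scope.
Local Open Scope quotient_scope.

HB.mixin Record Nmodule_isBinoid M of GRing.Nmodule M := {
  infty : M;
  addr_infty : forall a : M, a + infty = infty
}.

#[short(type="binoidType")]
HB.structure Definition Binoid :=
  { M of Nmodule_isBinoid M & GRing.Nmodule M }.

Definition cancellative (M : binoidType) : Prop :=
  forall a x y : M, a + x = a + y -> a + y <> infty -> x = y.

Definition torsion_free (M : binoidType) : Prop :=
  forall (n : nat) (x y : M),
    (1 <= n)%N -> x *+ n = y *+ n -> y *+ n <> infty -> x = y.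

(* The absorbing element is part of the signature, hence need not be a sum of
   generators. *)
Definition finitely_generated (M : binoidType) : Prop :=
  exists s : seq M, forall x : M, x <> infty ->
    exists2 t : seq M, {subset t <= s} & x = \sum_(y <- t) y.

Definition binoid_ideal (M : binoidType) (I : set M) : Prop :=
  I infty /\ forall a x : M, I x -> I (a + x).

Definition binoid_prime (M : binoidType) (I : set M) : Prop :=
  [/\ binoid_ideal I, I <> setT & forall a b : M, I (a + b) -> I a \/ I b].

Record binoid_spec (M : binoidType) := BinoidSpec {
  bprime :> set M;
  bprimeP : binoid_prime bprime
}.

HB.instance Definition _ (M : binoidType) := gen_eqMixin (binoid_spec M).
HB.instance Definition _ (M : binoidType) := gen_choiceMixin (binoid_spec M).

Section BinoidSpecTopology.
Variable M : binoidType.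

Definition binoid_basic_open (f : M) : set (binoid_spec M) :=
  [set p | ~ bprime p f].

Definition binoid_spec_open (U : set (binoid_spec M)) : Prop :=
  forall p, U p ->
    exists2 f, binoid_basic_open f p & binoid_basic_open f `<=` U.

Lemma bprime0 (p : binoid_spec M) : ~ bprime p 0.
Proof.
case: p => p [[_ pM] pT _] /= p0; apply: pT; rewrite predeqE => x; split=> // _.
by rewrite -[x]addr0; apply: pM.
Qed.

Lemma bprimeD (p : binoid_spec M) (a b : M) :
  bprime p (a + b) <-> bprime p a \/ bprime p b.
Proof.
case: p => p [[_ pM] pT pp] /=; split; first exact: pp.
by case=> h; [rewrite addrC|]; apply: pM.
Qed.

Let openT : binoid_spec_open setT.
Proof. by move=> p _; exists 0 => //; apply: bprime0. Qed.

Let openI (A B : set (binoid_spec M)) :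
  binoid_spec_open A -> binoid_spec_open B -> binoid_spec_open (A `&` B).
Proof.
move=> oA oB p [/oA[f fp fA] /oB[g gp gB]]; exists (f + g).
  by move=> /bprimeD[].
by move=> q /= fgq; split; [apply: fA|apply: gB] => h; apply: fgq;
  apply/bprimeD; [left|right].
Qed.

Let open_bigU (I : Type) (f : I -> set (binoid_spec M)) :
  (forall i, binoid_spec_open (f i)) -> binoid_spec_open (\bigcup_i f i).
Proof.
move=> of_ p [i _ /of_[g gp gf]]; exists g => //.
by move=> q /gf; exists i.
Qed.

HB.instance Definition _ :=
  isOpenTopological.Build (binoid_spec M) openT openI open_bigU.

Lemma binoid_spec_openE (U : set (binoid_spec M)) :
  open U = binoid_spec_open U.
Proof. by []. Qed.

End BinoidSpecTopology.

(* comPzRingType includes the zero ring, which is K[M] when infty = 0 in M. *)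

Definition ring_prime (R : comPzRingType) (P : set R) : Prop :=
  [/\ P 0, forall a b, P a -> P b -> P (a + b), forall r a, P a -> P (r * a),
      ~ P 1 & forall a b, P (a * b) -> P a \/ P b].

Record ring_spec (R : comPzRingType) := RingSpec {
  rprime :> set R;
  rprimeP : ring_prime rprime
}.

HB.instance Definition _ (R : comPzRingType) := gen_eqMixin (ring_spec R).
HB.instance Definition _ (R : comPzRingType) := gen_choiceMixin (ring_spec R).

Section RingSpecTopology.
Variable R : comPzRingType.

Definition ring_basic_open (f : R) : set (ring_spec R) :=
  [set p | ~ rprime p f].

Definition ring_spec_open (U : set (ring_spec R)) : Prop :=
  forall p, U p -> exists2 f, ring_basic_open f p & ring_basic_open f `<=` U.

Lemma rprimeM (p : ring_spec R) (a b : R) :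
  rprime p (a * b) <-> rprime p a \/ rprime p b.
Proof.
case: p => p [_ _ pM _ pp] /=; split; first exact: pp.
by case=> h; [rewrite mulrC|]; apply: pM.
Qed.

Let openT : ring_spec_open setT.
Proof. by move=> p _; exists 1 => //; case: (rprimeP p). Qed.

Let openI (A B : set (ring_spec R)) :
  ring_spec_open A -> ring_spec_open B -> ring_spec_open (A `&` B).
Proof.
move=> oA oB p [/oA[f fp fA] /oB[g gp gB]]; exists (f * g).
  by move=> /rprimeM[].
by move=> q /= fgq; split; [apply: fA|apply: gB] => h; apply: fgq;
  apply/rprimeM; [left|right].
Qed.

Let open_bigU (I : Type) (f : I -> set (ring_spec R)) :
  (forall i, ring_spec_open (f i)) -> ring_spec_open (\bigcup_i f i).
Proof.
move=> of_ p [i _ /of_[g gp gf]]; exists g => //.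
by move=> q /gf; exists i.
Qed.

HB.instance Definition _ :=
  isOpenTopological.Build (ring_spec R) openT openI open_bigU.

Lemma ring_spec_openE (U : set (ring_spec R)) :
  open U = ring_spec_open U.
Proof. by []. Qed.

End RingSpecTopology.

Definition binoid_alg (K : fieldType) (M : binoidType) : Type :=
  {malg K[{x : M | x != infty}]}.

HB.instance Definition _ (K : fieldType) (M : binoidType) :=
  GRing.Lmodule.on (binoid_alg K M).

Section BinoidAlgebra.
Variables (K : fieldType) (M : binoidType).
Local Notation KM := (binoid_alg K M).

(* T^mu: the basis vector of index mu if mu is not infty, and 0 otherwise *)
Definition binoid_T (mu : M) : KM :=
  if insub mu is Some m then mkmalgU m 1 else 0.

Definition binoid_mul (f g : KM) : KM :=
  \sum_(x <- msupp f) \sum_(y <- msupp g)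
    (mcoeff x f * mcoeff y g) *: binoid_T (val x + val y).

Lemma binoid_T_infty : binoid_T infty = 0.
Proof. by rewrite /binoid_T insubN // negbK. Qed.

Lemma mcoeff_T (mu : M) (x : {x : M | x != infty}) :
  mcoeff x (binoid_T mu) = (mu == val x)%:R.
Proof.
rewrite /binoid_T; case: insubP => [m _ <-|]; first by rewrite mcoeffU.
by rewrite negbK mcoeff0 => /eqP ->; rewrite eq_sym (negbTE (valP x)).
Qed.

Let ext (V : lmodType K) (h : M -> V) (f : KM) : V :=
  \sum_(x <- msupp f) mcoeff x f *: h (val x).

Let ext_w V h (f : KM) (d : {fset {x : M | x != infty}}) :
  (msupp f `<=` d)%fset -> @ext V h f = \sum_(x <- d) mcoeff x f *: h (val x).
Proof.
move=> fd; apply: (big_fset_incl _ fd) => x _ /mcoeff_outdom ->.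
by rewrite scale0r.
Qed.

Let extD V h f g : @ext V h (f + g) = ext h f + ext h g.
Proof.
have fd := fsubsetUl (msupp f) (msupp g).
have gd := fsubsetUr (msupp f) (msupp g).
rewrite (ext_w _ (msuppD_le f g)) (ext_w _ fd) (ext_w _ gd) -big_split /=.
by apply: eq_bigr => x _; rewrite mcoeffD scalerDl.
Qed.

Let extZ V h a f : @ext V h (a *: f) = a *: ext h f.
Proof.
rewrite (ext_w _ (msuppZ_le a f)) /ext scaler_sumr.
by apply: eq_bigr => x _; rewrite mcoeffZ scalerA.
Qed.

Let ext0 V h : @ext V h 0 = 0.
Proof. by rewrite /ext msupp0 big_seq_fset0. Qed.

Let extT (V : lmodType K) (h : M -> V) mu : h infty = 0 -> ext h (binoid_T mu) = h mu.
Proof.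
move=> h0; rewrite /binoid_T; case: insubP => [m _ <-|].
  by rewrite (ext_w _ msuppU_le) big_seq_fset1 mcoeffUU scale1r.
by rewrite negbK => /eqP ->; rewrite h0 ext0.
Qed.

Lemma binoid_algE (f : KM) :
  f = \sum_(x <- msupp f) mcoeff x f *: binoid_T (val x).
Proof.
rewrite {1}[f]monalgE; apply: eq_bigr => x _; rewrite /binoid_T valK.
by apply/malgP => k; rewrite mcoeffZ !mcoeffU mulrnAr mulr1.
Qed.

Lemma binoid_alg_ind (P : KM -> Prop) :
  P 0 -> (forall a mu f, P f -> P (a *: binoid_T mu + f)) -> forall f, P f.
Proof.
move=> P0 PS f; rewrite [f]binoid_algE; elim: (enum_fset _) => [|x s IH].
  by rewrite big_nil.
by rewrite big_cons; apply: PS.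
Qed.

Let mulE f g : binoid_mul f g
  = ext (fun m => ext (fun n => binoid_T (m + n)) g : KM) f.
Proof.
apply: eq_bigr => x _; rewrite scaler_sumr.
by apply: eq_bigr => y _; rewrite scalerA.
Qed.

Let mulC : commutative binoid_mul.
Proof.
move=> f g; rewrite /binoid_mul exchange_big; apply: eq_bigr => x _.
by apply: eq_bigr => y _; rewrite mulrC addrC.
Qed.

Let mulDl : left_distributive binoid_mul +%R.
Proof. by move=> f g h; rewrite !mulE extD. Qed.

Let mulDr f g h : binoid_mul f (g + h) = binoid_mul f g + binoid_mul f h.
Proof. by rewrite mulC mulDl !(mulC f). Qed.

Let mulZl a f g : binoid_mul (a *: f) g = a *: binoid_mul f g.
Proof. by rewrite !mulE extZ. Qed.

Let mulZr a f g : binoid_mul f (a *: g) = a *: binoid_mul f g.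
Proof. by rewrite mulC mulZl mulC. Qed.

Let mul0l f : binoid_mul 0 f = 0.
Proof. by rewrite mulE ext0. Qed.

Let mul0r' f : binoid_mul f 0 = 0.
Proof. by rewrite mulC mul0l. Qed.

Let mulTT mu nu :
  binoid_mul (binoid_T mu) (binoid_T nu) = binoid_T (mu + nu).
Proof.
rewrite mulE extT; first by rewrite extT // addr_infty binoid_T_infty.
by rewrite extT addrC ?addr_infty ?binoid_T_infty // addrC addr_infty binoid_T_infty.
Qed.

Let mul1 : left_id (binoid_T 0) binoid_mul.
Proof.
elim/binoid_alg_ind => [|a mu f IH]; first exact: mul0r'.
by rewrite mulDr IH mulZr mulTT add0r.
Qed.

Let bilinear_assoc (V : lmodType K) (mul : V -> V -> V) (T : M -> V) :
  (forall P : V -> Prop,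
     P 0 -> (forall a mu f, P f -> P (a *: T mu + f)) -> forall f, P f) ->
  (forall f g h, mul (f + g) h = mul f h + mul g h) ->
  (forall f g h, mul f (g + h) = mul f g + mul f h) ->
  (forall a f g, mul (a *: f) g = a *: mul f g) ->
  (forall a f g, mul f (a *: g) = a *: mul f g) ->
  (forall f, mul 0 f = 0) -> (forall f, mul f 0 = 0) ->
  (forall mu nu, mul (T mu) (T nu) = T (mu + nu)) -> associative mul.
Proof.
move=> ind Dl Dr Zl Zr m0l m0r TT f g h.
elim/ind: f => [|a x f IH]; first by rewrite !m0l.
rewrite !Dl {}IH !Zl; congr (_ *: _ + _).
elim/ind: g => [|b y g IH]; first by rewrite !(m0l, m0r).
rewrite !(Dl, Dr) {}IH !(Zl, Zr); congr (_ *: _ + _).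
elim/ind: h => [|c z h IH]; first by rewrite !m0r.
by rewrite !Dr {}IH !Zr !TT addrA.
Qed.

Let mulA : associative binoid_mul.
Proof.
exact: (bilinear_assoc binoid_alg_ind mulDl mulDr mulZl mulZr mul0l mul0r' mulTT).
Qed.

HB.instance Definition _ :=
  GRing.Zmodule_isComPzRing.Build KM mulA mulC mul1 mulDl.

Lemma binoid_T0 : binoid_T 0 = 1. Proof. by []. Qed.

Lemma binoid_TD mu nu : binoid_T (mu + nu) = binoid_T mu * binoid_T nu.
Proof. by rewrite -mulTT. Qed.

Lemma binoid_algZl (a : K) (f g : KM) : (a *: f) * g = a *: (f * g).
Proof. exact: mulZl. Qed.

Lemma binoid_algZr (a : K) (f g : KM) : f * (a *: g) = a *: (f * g).
Proof. exact: mulZr. Qed.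

(* K[I]: the K-span of the T^mu, mu in I *)
Definition binoid_alg_span (I : set M) : set KM :=
  [set f | exists2 s : seq (K * M), (forall c, c \in s -> I c.2) &
                                    f = \sum_(c <- s) c.1 *: binoid_T c.2].

Lemma span0 I : binoid_alg_span I 0.
Proof. by exists [::] => //; rewrite big_nil. Qed.

Lemma spanD I f g : binoid_alg_span I f -> binoid_alg_span I g ->
  binoid_alg_span I (f + g).
Proof.
move=> [s sI ->] [t tI ->]; exists (s ++ t); last by rewrite big_cat.
by move=> c; rewrite mem_cat => /orP[/sI|/tI].
Qed.

Lemma spanZT I a mu : I mu -> binoid_alg_span I (a *: binoid_T mu).
Proof.
move=> Imu; exists [:: (a, mu)]; last by rewrite big_seq1.
by move=> c; rewrite inE => /eqP ->.
Qed.

Lemma span_ind I (P : KM -> Prop) :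
  P 0 -> (forall a mu f, I mu -> P f -> P (a *: binoid_T mu + f)) ->
  forall f, binoid_alg_span I f -> P f.
Proof.
move=> P0 PS f [s + ->]; elim: s => [|c s IH] sI; first by rewrite big_nil.
rewrite big_cons; apply: PS; first by apply: sI; rewrite mem_head.
by apply: IH => d ds; apply: sI; rewrite inE ds orbT.
Qed.

Lemma spanM I f g : binoid_ideal I -> binoid_alg_span I g ->
  binoid_alg_span I (f * g).
Proof.
move=> [_ IM]; elim/span_ind: g / => [|a mu g Imu IH].
  by rewrite mulr0; apply: span0.
rewrite mulrDr; apply: spanD IH; rewrite binoid_algZr.
elim/binoid_alg_ind: f => [|b nu f IH].
  by rewrite mul0r scaler0; apply: span0.
rewrite mulrDl scalerDr; apply: spanD IH.
by rewrite binoid_algZl scalerA -binoid_TD; apply/spanZT/IM.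
Qed.

Lemma spanP I f : binoid_alg_span I f <->
  forall x : {x : M | x != infty}, mcoeff x f != 0 -> I (val x).
Proof.
split=> [|fI].
  elim/span_ind: f / => [|a mu f Imu IH] x; first by rewrite mcoeff0 eqxx.
  rewrite mcoeffD mcoeffZ mcoeff_T; have [<- //|_] := eqVneq mu (val x).
  by rewrite mulr0 add0r; apply: IH.
rewrite [f]binoid_algE big_seq_cond.
elim/big_ind: _ => [||x /andP[xf _]]; [exact: span0|exact: spanD|].
by apply/spanZT/fI; rewrite mcoeff_neq0.
Qed.

End BinoidAlgebra.

Section TotalOrder.
Variables (M : nmodType) (S : set M).
Hypotheses (S0 : S 0) (SD : forall x y, S (x + y) <-> S x /\ S y)
  (Scan : forall a x y, S (a + x) -> a + x = a + y -> x = y)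
  (Stf : forall n x y, (0 < n)%N -> S x -> x *+ n = y *+ n -> x = y).

Let good (A : set (M * M)) : Prop :=
  [/\ forall x y, A (x, y) -> S x /\ S y,
      forall x, S x -> A (x, x),
      forall x y x' y', A (x, y) -> A (x', y') -> A (x + x', y + y'),
      forall x y z, A (x + z, y + z) -> A (x, y) &
      forall x y, A (x, y) -> A (y, x) -> x = y].

Let SMn x n : S x -> S (x *+ n).
Proof. by move=> Sx; elim: n => [//|n IH]; rewrite mulrS; apply/SD. Qed.

Let diag_good : good [set u | S u.1 /\ u.1 = u.2].
Proof.
split=> /=.
- by move=> x y [Sx <-].
- by [].
- by move=> x y x' y' [Sx <-] [Sx' <-]; split=> //; apply/SD.
- move=> x y z [Sxz e]; have [Sx _] := (SD x z).1 Sxz; split=> //.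
  by apply: (Scan (a := z)); rewrite addrC // e addrC.
- by move=> x y [].
Qed.

Let good_max : exists A, good A /\ forall B, A `<` B -> ~ good B.
Proof.
have [F FP Ftot|A [PA maxA]] := @Zorn_bigcup _ [set A | A = set0 \/ good A].
  have [[A FA gA]|noA] := pselect (exists2 A, F A & good A); last first.
    left; rewrite -subset0 => u [A FA Au].
    by case: (FP _ FA) => [A0|gA]; [rewrite A0 in Au|case: noA; exists A].
  have goodF B u : F B -> B u -> good B.
    by move=> FB Bu; case: (FP _ FB) => // B0; rewrite B0 in Bu.
  have two B C u v : F B -> B u -> F C -> C v ->
      exists D, [/\ F D, good D, D u & D v].
    move=> FB Bu FC Cv.
    case: (Ftot _ _ FB FC) => [BC|CB]; [exists C|exists B]; split=> //.
    - exact: goodF Cv.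
    - exact: BC.
    - exact: goodF Bu.
    - exact: CB.
  right; split.
  - by move=> x y [B FB Bu]; case: (goodF _ _ FB Bu) => + _ _ _ _; apply.
  - by move=> x Sx; exists A => //; case: gA => _ + _ _ _; apply.
  - move=> x y x' y' [B FB Bu] [C FC Cv].
    have [D [FD [_ _ dD _ _] Du Dv]] := two _ _ _ _ FB Bu FC Cv.
    by exists D => //; apply: dD.
  - move=> x y z [B FB Bu]; exists B => //.
    by case: (goodF _ _ FB Bu) => _ _ _ + _; apply; exact: Bu.
  - move=> x y [B FB Bu] [C FC Cv].
    by have [D [FD [_ _ _ _ aD] Du Dv]] := two _ _ _ _ FB Bu FC Cv; apply: aD.
have gA : good A.
  case: PA => // A0; exfalso; apply: (maxA _ _ (or_intror diag_good)).
  rewrite A0 /proper; split; first exact: sub0set.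
  by move=> /(_ (0, 0)) /=; apply.
by exists A; split=> // B AB gB; apply: maxA AB _; right.
Qed.

(* Zorn's lemma extends equality on S to a total order compatible with +;
   every finite set of sums then has a uniquely attained maximum. *)
Lemma order_exists : exists A : M -> M -> Prop,
  [/\ forall x y z, S y -> A x y -> A y z -> A x z,
      forall x y, S x -> S y -> A x y \/ A y x,
      forall x y x' y', A x y -> A x' y' -> A (x + x') (y + y'),
      forall x y z, A (x + z) (y + z) -> A x y &
      (forall x y, A x y -> A y x -> x = y) /\ forall x, S x -> A x x].
Proof.
have [A [[AS Arefl AD AC Aanti] maxA]] := good_max.
have AMn k x y : A (x, y) -> A (x *+ k, y *+ k).
  move=> Axy; elim: k => [|k IH]; first exact: Arefl.
  by rewrite !mulrS; apply: AD.
have key a b : S a -> S b -> ~ A (a, b) ->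
    exists2 k, (0 < k)%N & A (b *+ k, a *+ k).
  move=> Sa Sb nab.
  pose B := [set u : M * M | [/\ S u.1, S u.2 &
               exists n, A (u.1 + b *+ n, u.2 + a *+ n)]].
  have [[x [y [n [m [Axy Ayx xy]]]]]|noB] := pselect (exists x y n m,
      [/\ A (x + b *+ n, y + a *+ n), A (y + b *+ m, x + a *+ m) & x <> y]).
    have k0 : (0 < n + m)%N.
      rewrite lt0n; apply/eqP => /eqP; rewrite addn_eq0 => /andP[/eqP n0 /eqP m0].
      by move: Axy Ayx; rewrite n0 m0 !mulr0n !addr0 => h h'; case: (xy (Aanti _ _ h h')).
    exists (n + m)%N => //; apply: (AC _ _ (x + y)).
    have := AD _ _ _ _ Axy Ayx.
    rewrite (addrACA x) (addrACA y) -!mulrnDr.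
    by rewrite (addrC (x + y)) (addrC y x) (addrC (x + y)).
  exfalso; apply: (maxA B).
    split=> [[x y] Axy|/(_ (a, b)) AB].
      by have [Sx Sy] := AS _ _ Axy; split=> //; exists 0%N; rewrite !mulr0n !addr0.
    apply: nab; apply: AB; split=> //; exists 1%N; rewrite !mulr1n /=.
    by rewrite (addrC b); apply/Arefl/SD.
  split.
  - by move=> x y [].
  - move=> x Sx; split=> //; exists 0%N; rewrite !mulr0n !addr0; exact: Arefl.
  - move=> x y x' y' [/= Sx Sy [n An]] [/= Sx' Sy' [m Am]].
    split=> /=; [exact/SD|exact/SD|exists (n + m)%N].
    by rewrite !mulrnDr (addrACA x) (addrACA y); apply: AD.
  - move=> x y z [/= /SD[Sx Sz] /SD[Sy _] [n An]]; split=> //; exists n => /=.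
    by apply: (AC _ _ z); rewrite addrAC (addrAC y).
  - move=> x y [/= _ _ [n An]] [/= _ _ [m Am]].
    by apply: contrapT => xy; apply: noB; exists x, y, n, m.
exists (fun x y => A (x, y)); split=> //.
- move=> x y z Sy Axy Ayz; apply: (AC _ _ y).
  by rewrite (addrC z); apply: AD.
- move=> a b Sa Sb; apply: contrapT => /not_orP[nab nba].
  have [k k0 Ak] := key _ _ Sa Sb nab; have [l l0 Al] := key _ _ Sb Sa nba.
  apply: nab; suff -> : a = b by apply: Arefl.
  apply: (Stf (n := (k * l)%N)) => //; first by rewrite muln_gt0 k0.
  apply: Aanti; last by rewrite !mulrnA; apply: AMn.
  by rewrite mulnC !mulrnA; apply: AMn.
Qed.

Lemma unique_sum (s t : seq M) :
  (forall x, x \in s -> S x) -> (forall x, x \in t -> S x) ->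
  s != [::] -> t != [::] ->
  exists a b, [/\ a \in s, b \in t & forall a' b', a' \in s -> b' \in t ->
    a' + b' = a + b -> a' = a /\ b' = b].
Proof.
have [A [Atr Atot AD AC [Aanti Arefl]]] := order_exists.
have maxi (u : seq M) : (forall x, x \in u -> S x) -> u != [::] ->
    exists2 a, a \in u & forall x, x \in u -> A x a.
  elim: u => // x u IH uS _; have Sx : S x by apply: uS; rewrite mem_head.
  have {}uS y : y \in u -> S y by move=> yu; apply: uS; rewrite inE yu orbT.
  have [u0|un] := eqVneq u [::].
    exists x; rewrite ?mem_head // => y; rewrite u0 inE => /eqP ->; exact: Arefl.
  have [a au amax] := IH uS un.
  have [xa|ax] := Atot _ _ Sx (uS _ au).
    exists a; first by rewrite inE au orbT.
    by move=> y; rewrite inE => /orP[/eqP -> //|]; apply: amax.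
  exists x; rewrite ?mem_head // => y; rewrite inE => /orP[/eqP -> |yu].
    exact: Arefl.
  exact: (Atr _ a) (uS _ au) (amax _ yu) ax.
move=> sS tS /(maxi s sS)[a as_ amax] /(maxi t tS)[b bt bmax].
exists a, b; split=> // a' b' a's b't e.
have a'E : a' = a.
  apply: Aanti (amax _ a's) _; apply: (AC _ _ b); rewrite -e.
  by apply: AD; [exact/Arefl/sS|exact: bmax].
split=> //; rewrite a'E in e; apply: Scan e.
by apply/SD; split; [exact: sS|exact: tS].
Qed.

End TotalOrder.

Section SpecEmbedding.
Variables (K : fieldType) (M : binoidType).
Hypotheses (Mtf : torsion_free M) (Mc : cancellative M).

Lemma binoid_alg_span_prime (p : binoid_spec M) :
  ring_prime (binoid_alg_span (K := K) p).
Proof.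
have pI : binoid_ideal p by case: p => ? [].
have pinf : bprime p infty by case: pI.
split.
- exact: span0.
- exact: spanD.
- by move=> r a; apply: spanM.
- rewrite -binoid_T0 => /spanP h; apply: (@bprime0 _ p).
  have [->//|n0] := eqVneq (0 : M) infty.
  by have := h (exist (fun x : M => is_true (x != infty)) _ n0); rewrite mcoeff_T /= eqxx oner_eq0; apply.
move=> f g fgp; apply: contrapT => /not_orP[/spanP nf /spanP ng].
pose S : set M := [set x | ~ bprime p x].
have Sinf x : S x -> x <> infty by move=> Sx xi; apply: Sx; rewrite xi.
have SD x y : S (x + y) <-> S x /\ S y.
  rewrite /S /=; split=> [h|[h h'] /bprimeD[] //].
  by split=> h'; apply: h; apply/bprimeD; [left|right].
have S0 : S 0 := @bprime0 _ p.
have Scan a x y : S (a + x) -> a + x = a + y -> x = y.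
  by move=> Sax e; apply: (Mc e); rewrite -e; apply: Sinf.
have Stf n x y : (0 < n)%N -> S x -> x *+ n = y *+ n -> x = y.
  move=> n0 Sx e; apply: (Mtf n0 e); rewrite -e; apply: Sinf.
  by elim: n {n0 e} => [|n IH]; [exact: S0|rewrite mulrS; apply/SD].
pose s (f : binoid_alg K M) := [seq val x | x <- msupp f & `[< S (val x) >]].
have sS h x : x \in s h -> S x.
  by move=> /mapP[y]; rewrite mem_filter => /andP[/asboolP Sy _] ->.
have s_neq0 h : ~ (forall x, mcoeff x h != 0 -> bprime p (val x)) -> s h != [::].
  apply: contra_notN => /eqP /(congr1 size) /eqP.
  rewrite size_map size_filter /= eqn0Ngt -has_count => /hasPn hs x xh.
  apply: contrapT => npx; have := hs x; rewrite -mcoeff_neq0 xh => /(_ isT).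
  by move/asboolP.
have [_ [_ [/mapP[a + ->] /mapP[b + ->] uniqab]]] :=
  unique_sum S0 SD Scan Stf (@sS f) (@sS g) (s_neq0 _ nf) (s_neq0 _ ng).
rewrite !mem_filter => /andP[/asboolP Sa af] /andP[/asboolP Sb bg].
have Sab : S (val a + val b) by apply/SD.
have abi : val a + val b != infty by apply/eqP/Sinf.
pose ab : {x : M | x != infty} :=
  exist (fun x : M => is_true (x != infty)) _ abi.
apply: (Sab); have := (spanP _ _).1 fgp ab; apply.
have -> : f * g = binoid_mul f g by [].
rewrite /binoid_mul raddf_sum (big_fsetD1 a) //= raddf_sum (big_fsetD1 b) //=.
rewrite mcoeffZ mcoeff_T eqxx mulr1.
have eq0 x y : x \in msupp f -> y \in msupp g -> (x, y) <> (a, b) ->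
    mcoeff ab ((mcoeff x f * mcoeff y g) *: binoid_T K (val x + val y)) = 0.
  move=> xf yg xy; rewrite mcoeffZ mcoeff_T /=; case: eqP => [e|]; last by rewrite mulr0.
  have /SD[Sx Sy] : S (val x + val y) by rewrite e.
  have [||/val_inj ex /val_inj ey] := uniqab (val x) (val y) _ _ e.
  - by apply/map_f; rewrite mem_filter xf andbT; apply/asboolP.
  - by apply/map_f; rewrite mem_filter yg andbT; apply/asboolP.
  by case: xy; rewrite ex ey.
rewrite big1_fset ?addr0; last first.
  move=> y; rewrite !inE => /andP[yb yg] _; apply: eq0 => // -[eyb].
  by rewrite eyb eqxx in yb.
rewrite big1_fset ?addr0; last first.
  move=> x; rewrite !inE => /andP[xa xf] _; rewrite raddf_sum /= big1_fset //.
  move=> y yg _; apply: eq0 => // -[exa _].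
  by rewrite exa eqxx in xa.
by rewrite mulf_neq0 // mcoeff_neq0.
Qed.

Definition spec_embedding (p : binoid_spec M) : ring_spec (binoid_alg K M) :=
  RingSpec (binoid_alg_span_prime p).

Lemma spec_embedding_continuous : continuous spec_embedding.
Proof.
apply/continuousP => A; rewrite ring_spec_openE binoid_spec_openE => oA p Ap.
have [f fp fA] := oA _ Ap.
have [x xf npx] : exists2 x : {x : M | x != infty}, mcoeff x f != 0 & ~ bprime p (val x).
  apply: contrapT => h; apply: fp; apply/spanP => x xf.
  by apply: contrapT => npx; apply: h; exists x.
exists (val x) => // q nqx; apply: fA => /spanP h; apply: nqx; exact: h.
Qed.

End SpecEmbedding.

Record opens (X : topologicalType) := Opens {
  opens_set :> set X;
  opensP : open opens_set
}.

Section Opens.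
Variables (X Y : topologicalType).

Definition opensT : opens X := Opens openT.

Definition opensI (U V : opens X) : opens X :=
  Opens (openI (opensP U) (opensP V)).

Definition opens_preimage (f : X -> Y) (fc : continuous f) (U : opens Y) :
  opens X := Opens ((continuousP f).1 fc U (opensP U)).

End Opens.
Arguments opensT {X}.

Record presheaf (X : topologicalType) := Presheaf {
  sections :> opens X -> zmodType;
  restr : forall U V : opens X, V `<=` U -> {additive sections U -> sections V};
  restr_id : forall (U : opens X) (UU : U `<=` U) (s : sections U),
    restr UU s = s;
  restr_comp : forall (U V W : opens X) (VU : V `<=` U) (WV : W `<=` V)
    (WU : W `<=` U) (s : sections U), restr WV (restr VU s) = restr WU s
}.

Definition sheaf_condition (X : topologicalType) (F : presheaf X) : Prop :=
  forall (U : opens X) (I : Type) (V : I -> opens X) (VU : forall i, V i `<=` U),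
    U `<=` \bigcup_i V i ->
    (forall s t : F U,
       (forall i, restr F (VU i) s = restr F (VU i) t) -> s = t) /\
    (forall s : (forall i, F (V i)),
       (forall i j, restr F (@subIsetl _ (V i) (V j) : opensI (V i) (V j) `<=` V i) (s i)
                  = restr F (@subIsetr _ (V i) (V j) : opensI (V i) (V j) `<=` V j) (s j)) ->
       exists t : F U, forall i, restr F (VU i) t = s i).

Record sheaf (X : topologicalType) := Sheaf {
  sheaf_presheaf :> presheaf X;
  sheafP : sheaf_condition sheaf_presheaf
}.

Record sheaf_mor (X : topologicalType) (F G : sheaf X) := SheafMor {
  mor_app :> forall U : opens X, {additive F U -> G U};
  mor_nat : forall (U V : opens X) (VU : V `<=` U) (s : F U),
    mor_app V (restr F VU s) = restr G VU (mor_app U s)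
}.

Section Pushforward.
Variables (X Y : topologicalType) (f : X -> Y) (fc : continuous f).
Variable F : sheaf X.

Let pre := opens_preimage fc.

Let preS (U V : opens Y) (VU : V `<=` U) : pre V `<=` pre U.
Proof. by move=> x /VU. Qed.

Definition pushforward_presheaf : presheaf Y := {|
  sections := fun U => F (pre U);
  restr := fun U V VU => restr F (preS VU);
  restr_id := fun U UU s => restr_id (preS UU) s;
  restr_comp := fun U V W VU WV WU s =>
    restr_comp (preS VU) (preS WV) (preS WU) s
|}.

Lemma pushforward_sheaf_condition : sheaf_condition pushforward_presheaf.
Proof.
move=> U I V VU cov.
have cov' : pre U `<=` \bigcup_i pre (V i).
  by move=> x /cov[i _ Vi]; exists i.
have [sep glue] :=
  @sheafP _ F _ _ (fun i => pre (V i)) (fun i => preS (VU i)) cov'.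
split; first exact: sep.
move=> s compat; apply: glue => i j.
have h : opensI (pre (V i)) (pre (V j)) `<=` pre (opensI (V i) (V j)) by [].
rewrite -(restr_comp (preS (@subIsetl _ (V i) (V j) :
    opensI (V i) (V j) `<=` V i)) h).
rewrite -(restr_comp (preS (@subIsetr _ (V i) (V j) :
    opensI (V i) (V j) `<=` V j)) h).
by have := congr1 (restr F h) (compat i j); apply.
Qed.

Definition pushforward : sheaf Y := Sheaf pushforward_sheaf_condition.

End Pushforward.

Definition injective_sheaf (X : topologicalType) (J : sheaf X) : Prop :=
  forall (A B : sheaf X) (f : sheaf_mor A B) (g : sheaf_mor A J),
    (forall U : opens X, injective (f U)) ->
    exists h : sheaf_mor B J,
      forall (U : opens X) (s : A U), h U (f U s) = g U s.

(* The image sheaf of f consists of the sections that locally lift along f. *)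
Definition in_image (X : topologicalType) (F G : sheaf X) (f : sheaf_mor F G)
    (U : opens X) (s : G U) : Prop :=
  forall x, opens_set U x -> exists (V : opens X) (VU : V `<=` U),
    opens_set V x /\ exists t : F V, f V t = restr G VU s.

Definition exact_at (X : topologicalType) (F G H : sheaf X)
    (f : sheaf_mor F G) (g : sheaf_mor G H) : Prop :=
  forall (U : opens X) (s : G U), in_image f s <-> g U s = 0.

(* 0 -> F -> I^0 -> I^1 -> I^2 -> ... *)
Record injective_resolution (X : topologicalType) (F : sheaf X) :=
  InjectiveResolution {
    res_term : nat -> sheaf X;
    res_aug : sheaf_mor F (res_term 0);
    res_diff : forall n, sheaf_mor (res_term n) (res_term n.+1);
    res_injective : forall n, injective_sheaf (res_term n);
    res_aug_inj : forall U : opens X, injective (res_aug U);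
    res_exact0 : exact_at res_aug (res_diff 0);
    res_exactS : forall n, exact_at (res_diff n) (res_diff n.+1)
  }.

Section Homology.
Variables (A B C : zmodType) (f : {additive A -> B}) (g : {additive B -> C}).

Definition cycle_pred : pred B := fun x => g x == 0.

Let cycle_closed : zmod_closed cycle_pred.
Proof.
split; first by rewrite unfold_in raddf0.
by move=> x y; rewrite !unfold_in raddfB => /eqP -> /eqP ->; rewrite subr0.
Qed.

HB.instance Definition _ := GRing.isZmodClosed.Build B cycle_pred cycle_closed.

Definition cycles := {x : B | cycle_pred x}.

HB.instance Definition _ := SubChoice.on cycles.
HB.instance Definition _ := [SubChoice_isSubZmodule of cycles by <:].

Definition boundary_pred : pred cycles :=
  fun x => `[< exists a : A, f a = val x >].

Let boundary_closed : zmod_closed boundary_pred.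
Proof.
split; first by apply/asboolP; exists 0; rewrite !raddf0.
move=> x y /asboolP[a fa] /asboolP[b fb]; apply/asboolP; exists (a - b).
by rewrite !raddfB fa fb.
Qed.

HB.instance Definition _ :=
  GRing.isZmodClosed.Build cycles boundary_pred boundary_closed.

Let boundaries : zmodClosed cycles :=
  GRing.ZmodClosed.clone cycles boundary_pred _.

Definition homology : zmodType := Quotient.quot boundaries.

Lemma homology_eq0P : (forall c : homology, c = 0) <->
  forall x : B, g x = 0 -> exists a : A, f a = x.
Proof.
have eqP' (u v : cycles) : \pi_(Quotient.quot boundaries) u = \pi v <->
    exists a, f a = val u - val v.
  split=> [/eqP|h]; first by rewrite -Quotient.idealrBE => /asboolP; rewrite raddfB.
  by apply/eqP; rewrite -Quotient.idealrBE; apply/asboolP; rewrite raddfB.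
split=> [H x gx|H c].
  have gx' : cycle_pred x by apply/eqP.
  pose z : cycles := exist (fun x => is_true (cycle_pred x)) x gx'.
  have /eqP' [a] : \pi_(Quotient.quot boundaries) z = \pi 0.
    by rewrite (H (\pi z)) (H (\pi 0)).
  move=> fa; exists a; rewrite fa raddf0; exact: addr0.
rewrite -[c]reprK -[0 : homology]reprK; apply/eqP'; apply: H.
rewrite raddfB; have /eqP -> := valP (repr c).
by have /eqP -> := valP (repr (0 : Quotient.quot boundaries)); rewrite subr0.
Qed.

End Homology.

(* H^j(X, F) computed with the resolution R: the j-th cohomology group of
   0 -> Gamma(X, I^0) -> Gamma(X, I^1) -> ... *)
Definition sheaf_cohomology (X : topologicalType) (F : sheaf X)
    (R : injective_resolution F) (j : nat) : zmodType :=
  match j with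
  | 0 => homology (\0 : {additive res_term R 0 opensT -> res_term R 0 opensT})
                  (res_diff R 0 opensT)
  | k.+1 => homology (res_diff R k opensT) (res_diff R k.+1 opensT)
  end.

(* H^j(X, F) = 0. Up to isomorphism the group does not depend on the chosen
   injective resolution; the first conjunct rules out vacuity of the second. *)
Definition sheaf_cohomology_vanishes (X : topologicalType) (F : sheaf X)
    (j : nat) : Prop :=
  inhabited (injective_resolution F) /\
  forall (R : injective_resolution F) (c : sheaf_cohomology R j), c = 0.

(* Main.v *)
(* Sending a prime P of K[M] to {mu | T^mu in P} gives a retraction r of i, and
   the stalk of i_* F at P is the stalk of F at r(P); hence i_* is exact.
   It also maps a product of skyscrapers with fibre Q/Z, which is injective, to
   another such product, so it turns a resolution of F by such products into an
   injective resolution of i_* F with the same global sections.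
   These stay exact: every open neighbourhood of the ideal of nonunits of M is
   all of Spec M, so taking global sections there is taking a stalk.

   Cokernel sheaves are avoided: a morphism f : F -> G is continued by the map
   from G to the product of skyscrapers indexed by all characters of stalks of G
   that vanish on the image of f. *)
From HB Require Import structures.
Require Import Defs.
From mathcomp Require Import all_boot all_algebra.
From mathcomp Require Import boolp classical_sets topology functions.

Set Implicit Arguments.
Unset Strict Implicit.
Unset Printing Implicit Defensive.

Import GRing.Theory Num.Theory.

Local Open Scope classical_set_scope.
Local Open Scope ring_scope.
Local Open Scope quotient_scope.

(** * Extension of characters with values in Q/Z *)

Definition rat_int : pred rat := fun q => q \is a Num.int.

Fact rat_int_zmod_closed : zmod_closed rat_int.
Proof. by split=> [|x y xi yi]; [exact: rpred0|exact: rpredB]. Qed.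

HB.instance Definition _ := GRing.isZmodClosed.Build rat rat_int rat_int_zmod_closed.

Definition QmodZ : zmodType :=
  Quotient.quot (GRing.ZmodClosed.clone rat rat_int _).

Definition toQmodZ (q : rat) : QmodZ := \pi q.

Fact toQmodZ_zmod_morphism : zmod_morphism toQmodZ.
Proof. by move=> x y; rewrite /toQmodZ !piE. Qed.

HB.instance Definition _ :=
  GRing.isZmodMorphism.Build rat QmodZ toQmodZ toQmodZ_zmod_morphism.

Lemma toQmodZ_eq0 (q : rat) : (toQmodZ q == 0) = (q \is a Num.int).
Proof. by rewrite -[0](raddf0 toQmodZ) /toQmodZ -Quotient.idealrBE subr0. Qed.

(** If q/n is an integer, then [d] is 0 and the class of 1/n serves instead, nonzero since [n]
    exceeds 1. Asking for [e != 0] is what later makes a character nonzero at a prescribed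
    element. *)
Lemma QmodZ_divisible (n : nat) (d : QmodZ) :
  (1 < n)%N -> exists2 e, e != 0 & e *+ n = d.
Proof.
move=> n1; have n0 : n%:R != 0 :> rat by rewrite pnatr_eq0 -lt0n ltnW.
have div q : toQmodZ (q / n%:R) *+ n = toQmodZ q.
  by rewrite -raddfMn -[_ *+ n]mulr_natr divfK.
rewrite -[d]reprK -/(toQmodZ _); move: (repr d) => {d} q.
have [q0|qn] := eqVneq (toQmodZ (q / n%:R)) 0; last by exists (toQmodZ (q / n%:R)).
exists (toQmodZ (n%:R^-1)).
  rewrite toQmodZ_eq0; apply/negP => /norm_intr_ge1; rewrite invr_eq0 => /(_ n0).
  by rewrite ger0_norm ?invr_ge0 ?ler0n // invf_ge1 ?ltr0n ?(ltnW n1) // lern1 leqNgt n1.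
rewrite -[in RHS](div q) q0 mul0rn -raddfMn -[_ *+ n]mulr_natr mulVf //.
by apply/eqP; rewrite toQmodZ_eq0.
Qed.

Section CharacterExtension.
Variable B : zmodType.
Implicit Types A : set (B * QmodZ).

(** The graph of a homomorphism to Q/Z from a subgroup of [B]; as sets of pairs, such graphs can be
    united along chains for Zorn's lemma. *)
Definition functional_subgroup A : Prop :=
  [/\ A 0, forall u v, A u -> A v -> A (u - v) & forall d, A (0, d) -> d = 0].

Lemma functional_subgroupMz A (u : B * QmodZ) (k : int) :
  functional_subgroup A -> A u -> A (u *~ k).
Proof.
move=> [A0 AB _] Au; have AN v : A v -> A (- v).
  by move=> Av; rewrite -[- v]sub0r; apply: AB.
have AM n : A (u *+ n).
  elim: n => [//|n IH]; rewrite mulrSr -[u in _ + u]opprK; apply: AB => //.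
  exact: AN.
by case: k => n; [exact: AM|rewrite NegzE mulrNz; exact/AN/AM].
Qed.

Lemma functional_subgroup_inj A b d d' :
  functional_subgroup A -> A (b, d) -> A (b, d') -> d = d'.
Proof.
move=> [_ AB A0] bd bd'; apply/eqP; rewrite -subr_eq0; apply/eqP/A0.
by rewrite -(subrr b); apply: (AB (b, d) (b, d')).
Qed.

(** Let [n] be the least positive number with [b *+ n] in the domain of [A]; it exceeds 1 because
    [b] is outside. An n-th part of the value there works: division with remainder makes every
    admissible [k] a multiple of [n]. *)
Lemma functional_subgroup_slope A b : functional_subgroup A ->
  (forall d, ~ A (b, d)) ->
  exists2 e, e != 0 & forall (k : nat) d, A (b *+ k, d) -> d = e *+ k.
Proof.
move=> gA nb.
have [[n0 [n0_gt0 [d0 An0]]]|noA] := pselect (exists n : nat, (0 < n)%N /\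
    exists d, A (b *+ n, d)); last first.
  (* No positive multiple of [b] is in the domain, so any nonzero [e] would do; this one has order
     2. *)
  have [e e0 _] := QmodZ_divisible 0 (isT : 1 < 2)%N.
  exists e => // -[|k] d Ak; first by case: gA => _ _; apply.
  by case: noA; exists k.+1; split=> //; exists d.
have exP : exists n, (0 < n)%N && `[< exists d, A (b *+ n, d) >].
  by exists n0; rewrite n0_gt0; apply/asboolP; exists d0.
case: (ex_minnP exP) => n /andP[n_gt0 /asboolP[d An]] nmin.
have n1 : (1 < n)%N.
  rewrite ltn_neqAle n_gt0 eq_sym andbT; apply/eqP => n1.
  by apply: (nb d); rewrite n1 in An.
have [e e0 eE] := QmodZ_divisible d n1; exists e => // k c Ak.
have [_ AB _] := gA.
have kE : b *+ (k %% n)%N = b *+ k - b *+ n *+ (k %/ n)%N.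
  by rewrite [in b *+ k](divn_eq k n) mulrnDr mulnC mulrnA addrC addKr.
have Ar : A (b *+ (k %% n)%N, c - d *+ (k %/ n)%N).
  rewrite kE; apply: (AB (b *+ k, c) (b *+ n *+ (k %/ n)%N, d *+ (k %/ n)%N)) => //.
  have := functional_subgroupMz (k %/ n)%N gA An.
  by rewrite -pmulrn [X in A X]surjective_pairing !raddfMn.
have [r0|r_gt0] := posnP (k %% n)%N.
  rewrite (divn_eq k n) r0 addn0 mulnC mulrnA eE; apply/eqP; rewrite -subr_eq0.
  by apply/eqP; case: gA => _ _; apply; rewrite r0 in Ar.
suff /nmin : (0 < k %% n)%N && `[< exists d, A (b *+ (k %% n)%N, d) >].
  by rewrite leqNgt ltn_mod n_gt0.
by rewrite r_gt0; apply/asboolP; exists (c - d *+ (k %/ n)%N).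
Qed.

Lemma functional_subgroup_adjoin A b : functional_subgroup A ->
  (forall d, ~ A (b, d)) ->
  exists A' e, [/\ functional_subgroup A', A `<=` A', A' (b, e) & e != 0].
Proof.
move=> gA nb; have [e e0 slope] := functional_subgroup_slope gA nb.
have [A0 AB A1] := gA.
exists [set u | exists v k, A v /\ u = v + (b, e) *~ k], e; split=> //.
- split.
  + by exists 0, 0; rewrite mulr0z addr0.
  + move=> _ _ [v [k [Av ->]]] [w [l [Aw ->]]]; exists (v - w), (k - l).
    by split; [exact: AB|rewrite mulrzBr opprD addrACA].
  + move=> d [v [k [Av]]] /eqP; rewrite -subr_eq -mulrNz.
    (* [slope] covers natural multiples only, so for a negative multiple the pair is negated
       first. *)
    move=> /eqP vE; rewrite -vE in Av; case: (- k) Av => n {vE}.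
      rewrite [X in A X]surjective_pairing /= -!pmulrn !raddfMn /= add0r.
      by move=> /slope /eqP; rewrite -subr_eq0 addrK => /eqP.
    move=> /(functional_subgroupMz (-1) gA).
    rewrite mulrN1z NegzE mulrNz opprD opprK [X in A X]surjective_pairing /=.
    rewrite -!pmulrn !raddfMn /= oppr0 add0r.
    move=> /slope /eqP; rewrite -subr_eq0 addrK oppr_eq0.
    by move=> /eqP.
- by move=> u Au; exists u, 0; rewrite mulr0z addr0.
- by exists 0, 1; rewrite mulr1z add0r.
Qed.

Lemma functional_subgroup_total A : functional_subgroup A ->
  exists A', [/\ functional_subgroup A', A `<=` A' & forall b, exists d, A' (b, d)].
Proof.
(* Zorn is applied to the sets whose union with [A] is a graph, so that the empty chain, whose union
   is empty, also has its bound in the family. *)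
move=> gA; have [F FP Ftot|A' [gA' maxA']] :=
  @Zorn_bigcup _ [set A' | functional_subgroup (A `|` A')].
  have [A0 AB A1] := gA.
  have common u v : (A `|` \bigcup_(X in F) X) u -> (A `|` \bigcup_(X in F) X) v ->
      exists C, [/\ functional_subgroup C, C `<=` A `|` \bigcup_(X in F) X, C u & C v].
    have FU X : F X -> A `|` X `<=` A `|` \bigcup_(X in F) X.
      by move=> FX w [Aw|Xw]; [left|right; exists X].
    move=> [Au|[X FX Xu]] [Av|[Y FY Yv]].
    - by exists A; split=> // w; left.
    - by exists (A `|` Y); split; [exact: FP|exact: FU|left|right].
    - by exists (A `|` X); split; [exact: FP|exact: FU|right|left].
    have [XY|YX] := Ftot _ _ FX FY.
      by exists (A `|` Y); split; [exact: FP|exact: FU|right; exact: XY|right].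
    by exists (A `|` X); split; [exact: FP|exact: FU|right|right; exact: YX].
  split; first by left.
    move=> u v Uu Uv; have [C [[_ CB _] CU Cu Cv]] := common _ _ Uu Uv.
    by apply/CU/CB.
  by move=> d Ud; have [C [[_ _ C0] _ Cd _]] := common _ _ Ud Ud; exact: C0.
exists (A `|` A'); split; [exact: gA'|by move=> u; left|].
move=> b; apply: contrapT => /forallNP nb.
have [A'' [e [gA'' AA'' A''b _]]] := functional_subgroup_adjoin gA' nb.
apply: (maxA' A''); first split.
- by move=> u A'u; apply: AA''; right.
- by move=> A''A'; apply: (nb e); right; exact: A''A'.
- by rewrite /= setUidr // => u Au; apply: AA''; left.
Qed.

(** Q/Z is an injective cogenerator. To get [h b0 <> 0], the element [b0] is adjoined with a nonzero
    value before the domain is enlarged to all of [B]. *)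
Lemma character_extension A b0 : functional_subgroup A ->
  exists h : {additive B -> QmodZ},
    (forall b d, A (b, d) -> h b = d) /\
    ((forall d, ~ A (b0, d)) -> h b0 <> 0).
Proof.
move=> gA.
have [A' [gA' AA' nzA']] : exists A', [/\ functional_subgroup A', A `<=` A' &
    (forall d, ~ A (b0, d)) -> exists2 e, A' (b0, e) & e != 0].
  have [[d Ad]|/forallNP nb] := pselect (exists d, A (b0, d)).
    by exists A; split=> // /(_ d).
  have [A' [e [gA' AA' A'b e0]]] := functional_subgroup_adjoin gA nb.
  by exists A'; split=> // _; exists e.
have [C [gC A'C /choice[h hC]]] := functional_subgroup_total gA'.
have hE b d : C (b, d) -> h b = d by exact: functional_subgroup_inj.
have hB : zmod_morphism h.
  by move=> x y; apply: hE; case: gC => _ CB _; apply: (CB (x, h x) (y, h y)).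
pose hm := GRing.isZmodMorphism.Build _ _ h hB.
pose h' : {additive B -> QmodZ} := HB.pack h hm.
exists h'; split=> [b d /AA'/A'C/hE //|/nzA'[e /A'C/hE /= -> /eqP]].
exact.
Qed.

End CharacterExtension.

(** * Characters of stalks *)

Section SectionFamilies.
Variables (X : topologicalType) (G : presheaf X).

(** A single group receiving every [G U], so that a character of a stalk can be extended without
    forming a direct limit. *)
Definition section_family := forall V : opens X, G V.

HB.instance Definition _ := gen_eqMixin section_family.
HB.instance Definition _ := gen_choiceMixin section_family.

Implicit Types s t : section_family.

Let add s t : section_family := fun V => s V + t V.
Let opp s : section_family := fun V => - s V.
Let zero : section_family := fun V => 0.

Let addA : associative add.
Proof. by move=> s t u; apply: functional_extensionality_dep => V; apply: addrA. Qed.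
Let addC : commutative add.
Proof. by move=> s t; apply: functional_extensionality_dep => V; apply: addrC. Qed.
Let add0 : left_id zero add.
Proof. by move=> s; apply: functional_extensionality_dep => V; apply: add0r. Qed.
Let addN : left_inverse zero opp add.
Proof. by move=> s; apply: functional_extensionality_dep => V; apply: addNr. Qed.

HB.instance Definition _ := GRing.isZmodule.Build section_family addA addC add0 addN.

Definition family_of_section (U : opens X) (s : G U) : section_family :=
  fun V => if pselect (V `<=` U) is left VU then restr G VU s else 0.

Fact family_of_section_zmod_morphism U : zmod_morphism (@family_of_section U).
Proof.
move=> s t; apply: functional_extensionality_dep => V.
change (family_of_section (s - t) V = family_of_section s V - family_of_section t V).
rewrite /family_of_section.
by case: pselect => VU; [rewrite raddfB|rewrite subr0].
Qed.

HB.instance Definition _ U := GRing.isZmodMorphism.Build (G U) section_family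
  (@family_of_section U) (@family_of_section_zmod_morphism U).

Lemma family_of_sectionE (U V : opens X) (VU : V `<=` U) (s : G U) :
  family_of_section s V = restr G VU s.
Proof.
rewrite /family_of_section; case: pselect => // VU'.
by rewrite (Prop_irrelevance VU' VU).
Qed.

End SectionFamilies.

(* A character of the stalk at [x], presented as a cocone over the
   neighbourhoods of [x]; the values on other opens are irrelevant. *)
Record local_character (X : topologicalType) (G : presheaf X) (x : X) :=
  LocalCharacter {
    local_char :> forall U : opens X, {additive G U -> QmodZ};
    local_char_restr : forall (U V : opens X) (VU : V `<=` U) (s : G U),
      opens_set V x -> local_char V (restr G VU s) = local_char U s
  }.

(* The extension is performed on families of sections over all opens; two
   families agreeing on all small neighbourhoods of [x] get the same value. *)
Lemma local_character_extension (X : topologicalType) (G : presheaf X) (x : X)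
    (A : forall U : opens X, set (G U * QmodZ)) :
  (forall U : opens X, opens_set U x -> functional_subgroup (A U)) ->
  (forall (U V : opens X) (VU : V `<=` U) s d,
     opens_set V x -> A U (s, d) -> A V (restr G VU s, d)) ->
  forall (U0 : opens X) (s0 : G U0), opens_set U0 x ->
  exists phi : local_character G x,
    (forall (U : opens X) s d, opens_set U x -> A U (s, d) -> phi U s = d) /\
    ((forall (V : opens X) (VU : V `<=` U0), opens_set V x ->
        forall d, ~ A V (restr G VU s0, d)) -> phi U0 s0 <> 0).
Proof.
move=> gA Ares U0 s0 U0x.
(* [A'] transfers the prescribed values to families through their behaviour near [x]. It pairs
   families vanishing on all small opens with 0, which forces invariance under restriction. *)
pose A' : set (section_family G * QmodZ) := [set u | exists (U : opens X) s,
  [/\ opens_set U x, A U (s, u.2) &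
      forall (V : opens X) (VU : V `<=` U), u.1 V = restr G VU s]].
have gA' : functional_subgroup A'.
  split.
  - exists opensT, 0; have [A0 _ _] := gA opensT Logic.I.
    by split=> // V VU; rewrite raddf0.
  - move=> [b d] [b' d'] [U [s [Ux As bs]]] [U' [s' [U'x As' bs']]].
    pose W := opensI U U'; have Wx : opens_set W x by [].
    have WU : W `<=` U := @subIsetl _ _ _; have WU' : W `<=` U' := @subIsetr _ _ _.
    have [_ AB _] := gA W Wx.
    exists W, (restr G WU s - restr G WU' s'); split=> //.
      by apply: (AB (_, _) (_, _)); exact: Ares.
    move=> V VW; have VU := subset_trans VW WU; have VU' := subset_trans VW WU'.
    change (b V - b' V = restr G VW (restr G WU s - restr G WU' s')).
    by rewrite raddfB !(restr_comp _ _ VU, restr_comp _ _ VU') -(bs _ VU) -(bs' _ VU').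
  - move=> d [U [s [/= Ux As s0E]]]; have [_ _] := gA U Ux; apply.
    have UU : U `<=` U by [].
    have sE : s = 0 by rewrite -[s](restr_id UU) -(s0E U UU).
    by rewrite sE in As.
have [h [hA' hne]] := character_extension (family_of_section s0) gA'.
pose phi U : {additive G U -> QmodZ} := h \o @family_of_section X G U.
have phi_restr (U V : opens X) (VU : V `<=` U) (s : G U) :
    opens_set V x -> phi V (restr G VU s) = phi U s.
  move=> Vx; apply/eqP; rewrite -subr_eq0 /= -raddfB; apply/eqP/hA'.
  exists V, 0; split=> //=; first by have [] := gA V Vx.
  move=> W WV; have WU := subset_trans WV VU.
  change (family_of_section (restr G VU s) W - family_of_section s W = restr G WV 0).
  rewrite (family_of_sectionE WV) (family_of_sectionE WU).
  by rewrite (restr_comp VU WV WU) subrr raddf0.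
exists (LocalCharacter phi_restr); split=> [U s d Ux As|nA] /=.
  by apply: hA'; exists U, s; split=> // V VU; exact: family_of_sectionE.
apply: hne => d [W [s [/= Wx As s0s]]].
pose V := opensI U0 W; have VU : V `<=` U0 := @subIsetl _ _ _.
have VW : V `<=` W := @subIsetr _ _ _.
apply: (nA V VU _ d); first by split.
by rewrite -family_of_sectionE (s0s V VW); apply: Ares.
Qed.

(** * Products of skyscraper sheaves *)

Section Sky.
Variables (X : topologicalType) (I : Type) (p : I -> X).

(** Indexing by [I] rather than by points allows many factors at one point, one for each character
    of a stalk. *)
Definition sky_sections (U : opens X) : zmodType :=
  {i : I | opens_set U (p i)} -> QmodZ.

Definition sky_restr_fun (U V : opens X) (VU : V `<=` U)
    (s : sky_sections U) : sky_sections V :=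
  fun z => s (exist _ (sval z) (VU _ (svalP z))).

Fact sky_restr_zmod_morphism (U V : opens X) (VU : V `<=` U) :
  zmod_morphism (sky_restr_fun VU).
Proof. by []. Qed.

HB.instance Definition _ (U V : opens X) (VU : V `<=` U) :=
  GRing.isZmodMorphism.Build (sky_sections U) (sky_sections V)
    (sky_restr_fun VU) (sky_restr_zmod_morphism VU).

Definition sky_restr (U V : opens X) (VU : V `<=` U) :
  {additive sky_sections U -> sky_sections V} := sky_restr_fun VU.

Lemma sky_section_irrel (U : opens X) (s : sky_sections U) i
    (Ui Ui' : opens_set U (p i)) : s (exist _ i Ui) = s (exist _ i Ui').
Proof. by rewrite (Prop_irrelevance Ui Ui'). Qed.

Fact sky_restr_id (U : opens X) (UU : U `<=` U) s : sky_restr UU s = s.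
Proof. by apply/funext => -[i Ui]; exact: (sky_section_irrel s). Qed.

Fact sky_restr_comp (U V W : opens X) (VU : V `<=` U) (WV : W `<=` V)
  (WU : W `<=` U) s : sky_restr WV (sky_restr VU s) = sky_restr WU s.
Proof. by apply/funext => -[i Wi]; exact: (sky_section_irrel s). Qed.

Definition sky_presheaf : presheaf X := Presheaf sky_restr_id sky_restr_comp.

Fact sky_sheaf_condition : sheaf_condition sky_presheaf.
Proof.
move=> U J V VU cov; split=> [s t st|s compat].
  apply/funext => -[i Ui]; have [j _ Vj] := cov _ Ui.
  have := congr1 (fun s => s (exist _ i Vj)) (st j).
  by rewrite /= /sky_restr_fun /= !(sky_section_irrel _ _ Ui).
have cov' (z : {i : I | opens_set U (p i)}) : exists j, opens_set (V j) (p (sval z)).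
  by case: z => i Ui; have [j _ Vj] := cov _ Ui; exists j.
exists (fun z => s _ (exist _ (sval z) (svalP (cid (cov' z))))) => j.
apply/funext => -[i Vji]; rewrite /= /sky_restr_fun /=.
case: cid => k Vki /=.
have := congr1 (fun s => s (exist _ i (conj Vki Vji))) (compat k j).
rewrite /= /sky_restr_fun /= (sky_section_irrel (s k) _ Vki).
rewrite (sky_section_irrel (s j) _ Vji) => <-.
exact: (sky_section_irrel (s k)).
Qed.

Definition sky : sheaf X := Sheaf sky_sheaf_condition.

Section FromCharacters.
Variables (G : sheaf X) (phi : forall i, local_character G (p i)).

Definition to_sky_fun (U : opens X) (s : G U) : sky U :=
  fun z => phi (sval z) U s.

Fact to_sky_zmod_morphism U : zmod_morphism (@to_sky_fun U).
Proof. by move=> s t; apply/funext => z; rewrite /to_sky_fun raddfB. Qed.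

HB.instance Definition _ U := GRing.isZmodMorphism.Build (G U) (sky U)
  (@to_sky_fun U) (@to_sky_zmod_morphism U).

Fact to_sky_natural (U V : opens X) (VU : V `<=` U) (s : G U) :
  to_sky_fun (restr G VU s) = restr sky VU (to_sky_fun s).
Proof. by apply/funext => -[i Vi]; apply: local_char_restr. Qed.

Definition to_sky : sheaf_mor G sky :=
  @SheafMor X G sky (fun U => @to_sky_fun U) to_sky_natural.

End FromCharacters.

(** For each index [i], the kernel condition makes the pairs of [g b] and the [i]-th coordinate of
    [m b] a graph near [p i]. It extends to a character of [C] there, and these characters are the
    coordinates of [n]. *)
Lemma sky_extension (B C : sheaf X) (g : sheaf_mor B C) (m : sheaf_mor B sky) :
  (forall U b, g U b = 0 -> m U b = 0) ->
  exists n : sheaf_mor C sky, forall U b, n U (g U b) = m U b.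
Proof.
move=> gm.
have char i : exists phi : local_character C (p i), forall (U : opens X) b
    (Ui : opens_set U (p i)), phi U (g U b) = m U b (exist _ i Ui).
  pose A (U : opens X) : set (C U * QmodZ) := [set u | exists b
    (Ui : opens_set U (p i)), g U b = u.1 /\ m U b (exist _ i Ui) = u.2].
  have [|||phi [phiE _]] := @local_character_extension _ C (p i) A _ _ opensT 0.
  - move=> U Ui; split.
    + by exists 0, Ui; rewrite !raddf0.
    + move=> u v [b [Ub [bu1 bu2]]] [c [Uc [cv1 cv2]]]; exists (b - c), Ui.
      rewrite !raddfB bu1 cv1; split=> //=.
      by rewrite -bu2 -cv2 !(sky_section_irrel _ _ Ui).
    + by move=> d [b [Ub [/= /gm -> <-]]].
  - move=> U V VU s d Vi [b [Ui [/= gb mb]]]; exists (restr B VU b), Vi.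
    rewrite !mor_nat gb; split=> //=; rewrite -mb /sky_restr_fun /=.
    exact: sky_section_irrel.
  - by [].
  by exists phi => U b Ui; apply: phiE => //; exists b, Ui.
exists (to_sky (fun i => sval (cid (char i)))) => U b.
by apply/funext => -[i Ui]; rewrite /= /to_sky_fun /=; case: cid => phi /= ->.
Qed.

Lemma sky_injective : injective_sheaf sky.
Proof.
move=> A B f g finj; apply: sky_extension => U a; rewrite -(raddf0 (f U)).
by move=> /finj ->; rewrite raddf0.
Qed.

End Sky.

(** * Continuing a morphism by characters that kill its image *)

Section SkyCokernel.
Variables (X : topologicalType) (F G : sheaf X) (f : sheaf_mor F G).

Definition killing_character := {z : {x : X & local_character G x} |
  forall (U : opens X) t, opens_set U (projT1 z) -> projT2 z U (f U t) = 0}.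

Definition killing_point (z : killing_character) : X := projT1 (sval z).

Definition sky_coker : sheaf_mor G (sky killing_point) :=
  to_sky (fun z : killing_character => projT2 (sval z)).

(** If [s] has no lift near some [x], the zero character on the image of [f] extends to a character
    at [x] that is nonzero on [s]. It is one of the indices, so [sky_coker] detects [s]. *)
Lemma sky_coker_exact : exact_at f sky_coker.
Proof.
move=> U s; split=> [im|s0 x Ux].
  apply/funext => -[z Uz]; have [V [VU [Vz [t ft]]]] := im _ Uz.
  rewrite /= /to_sky_fun /= -(local_char_restr _ VU) // -ft.
  by apply: (svalP z).
apply: contrapT => nim.
pose A (V : opens X) : set (G V * QmodZ) :=
  [set u | u.2 = 0 /\ exists t, f V t = u.1].
have [|||phi [phiE phis]] := @local_character_extension _ G x A _ _ U s.
- move=> V Vx; split.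
  + by split=> //; exists 0; rewrite raddf0.
  + move=> u v [u0 [t tu]] [v0 [t' tv]]; split; first by rewrite /= u0 v0 subr0.
    by exists (t - t'); rewrite raddfB tu tv.
  + by move=> d [].
- move=> V W WV t d Wx [/= d0 [t' ft']]; split=> //.
  by exists (restr F WV t'); rewrite mor_nat ft'.
- by [].
have phi_killing (V : opens X) t : opens_set V x -> phi V (f V t) = 0.
  by move=> Vx; apply: phiE => //; split=> //; exists t.
pose z : killing_character := exist _ (existT _ x phi) phi_killing.
apply: phis => [V VU Vx d [_ [t ft]]|].
  by apply: nim; exists V, VU; split=> //; exists t.
exact: (congr1 (fun s => s (exist _ z Ux)) s0).
Qed.

End SkyCokernel.

(** * Exactness and injectivity of sheaves; the skyscraper resolution *)

Section SheafMorphisms.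
Variable X : topologicalType.

Definition mor_id (F : sheaf X) : sheaf_mor F F :=
  @SheafMor X F F (fun U => idfun) (fun _ _ _ _ => erefl).

Fact mor0_natural (F G : sheaf X) (U V : opens X) (VU : V `<=` U) (s : F U) :
  0 = restr G VU 0.
Proof. by rewrite raddf0. Qed.

Definition mor0 (F G : sheaf X) : sheaf_mor F G :=
  @SheafMor X F G (fun U => \0) (@mor0_natural F G).

Fact mor_comp_natural (F G H : sheaf X) (g : sheaf_mor G H) (f : sheaf_mor F G)
    (U V : opens X) (VU : V `<=` U) (s : F U) :
  (g V \o f V) (restr F VU s) = restr H VU ((g U \o f U) s).
Proof. by rewrite /= !mor_nat. Qed.

Definition mor_comp (F G H : sheaf X) (g : sheaf_mor G H) (f : sheaf_mor F G) :
  sheaf_mor F H := @SheafMor X F H (fun U => g U \o f U) (mor_comp_natural g f).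

Fact mor_sub_natural (F G : sheaf X) (f g : sheaf_mor F G)
    (U V : opens X) (VU : V `<=` U) (s : F U) :
  (f V \- g V) (restr F VU s) = restr G VU ((f U \- g U) s).
Proof. by rewrite /= !mor_nat raddfB. Qed.

Definition mor_sub (F G : sheaf X) (f g : sheaf_mor F G) : sheaf_mor F G :=
  @SheafMor X F G (fun U => f U \- g U) (mor_sub_natural f g).

Lemma section_locally0 (F : sheaf X) (U : opens X) (s : F U) :
  (forall x, opens_set U x -> exists (V : opens X) (VU : V `<=` U),
    opens_set V x /\ restr F VU s = 0) -> s = 0.
Proof.
move=> s0; pose x (z : {x | opens_set U x}) := s0 (sval z) (svalP z).
pose V z := sval (cid (x z)).
have VP z : exists VU : V z `<=` U, opens_set (V z) (sval z) /\ restr F VU s = 0.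
  exact: svalP (cid (x z)).
have VU z : V z `<=` U by have [VU _] := VP z.
have cov : U `<=` \bigcup_z V z.
  by move=> y Uy; exists (exist _ y Uy) => //; have [? []] := VP (exist _ y Uy).
have [sep _] := @sheafP X F U _ V VU cov; apply: sep => z.
by have [VU' [_ s0z]] := VP z; rewrite raddf0 (Prop_irrelevance (VU z) VU').
Qed.

(** A section killed by [g] lifts locally along [f], so its image under [m] is locally zero, hence
    zero by separation. *)
Lemma exact_kernel (F G H J : sheaf X) (f : sheaf_mor F G) (g : sheaf_mor G H)
    (m : sheaf_mor G J) : exact_at f g -> (forall U a, m U (f U a) = 0) ->
  forall U b, g U b = 0 -> m U b = 0.
Proof.
move=> fg mf U b /fg im; apply: section_locally0 => x Ux.
have [V [VU [Vx [t ft]]]] := im x Ux.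
by exists V, VU; split=> //; rewrite -mor_nat -ft mf.
Qed.

Lemma exact_comp0 (F G H : sheaf X) (f : sheaf_mor F G) (g : sheaf_mor G H) :
  exact_at f g -> forall U a, g U (f U a) = 0.
Proof.
by move=> fg U a; apply/fg => x Ux; exists U, (@subset_refl _ _); split=> //;
  exists a; rewrite restr_id.
Qed.

(** Applied to [sky_coker (mor0 F F)]: every character kills the zero image, so [F] embeds in the
    product over all characters of its stalks. *)
Lemma exact0_inj (F G H : sheaf X) (g : sheaf_mor G H) :
  exact_at (mor0 F G) g -> forall U, injective (g U).
Proof.
move=> e U; apply: raddf_inj => s gs0.
exact: (exact_kernel (m := mor_id G) e (fun _ _ => erefl) gs0).
Qed.

Lemma injective_retract (J J' : sheaf X) (a : sheaf_mor J J') (b : sheaf_mor J' J) :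
  (forall U s, b U (a U s) = s) -> injective_sheaf J' -> injective_sheaf J.
Proof.
move=> ba J'inj A B f g finj; have [h hf] := J'inj A B f (mor_comp a g) finj.
by exists (mor_comp b h) => U s; rewrite /= hf /= ba.
Qed.

(* [J] is a retract of a product of skyscrapers, where extending along
   non-injective morphisms does not require the image sheaf. *)
Lemma injective_extension (J B C : sheaf X) (g : sheaf_mor B C) (m : sheaf_mor B J) :
  injective_sheaf J -> (forall U b, g U b = 0 -> m U b = 0) ->
  exists n : sheaf_mor C J, forall U b, n U (g U b) = m U b.
Proof.
move=> Jinj gm; pose c := sky_coker (mor0 J J).
have [r rc] := Jinj _ _ c (mor_id J) (exact0_inj (sky_coker_exact (mor0 J J))).
have [|n ng] := sky_extension (g := g) (m := mor_comp c m).
  by move=> U b /gm mb; rewrite /= mb raddf0.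
by exists (mor_comp r n) => U b; rewrite [LHS]/= ng /= rc.
Qed.

(** The recursion for the resolution must carry the last morphism together with its source and
    target, as the next target is built from that morphism. Arrow 0 is the augmentation, arrow
    [n.+1] the differential in degree [n]. *)
Record sky_arrow := SkyArrow {
  sky_arrow_src : sheaf X;
  sky_arrow_index : Type;
  sky_arrow_pt : sky_arrow_index -> X;
  sky_arrow_mor : sheaf_mor sky_arrow_src (sky sky_arrow_pt)
}.

Fixpoint sky_arrows (F : sheaf X) (n : nat) : sky_arrow :=
  if n is n.+1 then SkyArrow (sky_coker (sky_arrow_mor (sky_arrows F n)))
  else SkyArrow (sky_coker (mor0 F F)).

Definition sky_term (F : sheaf X) (n : nat) : sheaf X :=
  sky (@sky_arrow_pt (sky_arrows F n)).

Definition sky_aug (F : sheaf X) : sheaf_mor F (sky_term F 0) :=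
  sky_arrow_mor (sky_arrows F 0).

Definition sky_diff (F : sheaf X) (n : nat) :
  sheaf_mor (sky_term F n) (sky_term F n.+1) := sky_arrow_mor (sky_arrows F n.+1).

Lemma sky_aug_inj (F : sheaf X) (U : opens X) : injective (sky_aug F U).
Proof. exact: exact0_inj (sky_coker_exact (mor0 F F)) _. Qed.

Lemma sky_exact0 (F : sheaf X) : exact_at (sky_aug F) (sky_diff F 0).
Proof. exact: sky_coker_exact. Qed.

Lemma sky_exactS (F : sheaf X) n : exact_at (sky_diff F n) (sky_diff F n.+1).
Proof. exact: sky_coker_exact. Qed.

End SheafMorphisms.

(** * Comparison of injective resolutions *)

(** [Q] is the invariant that makes the next choice possible. Chain maps and homotopies are both
    built degree by degree in this way. *)
Lemma nat_dependent_choice (T : nat -> Type) (P : forall n, T n -> T n.+1 -> Prop)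
    (Q : forall n, T n -> Prop) (t0 : T 0%N) : Q 0%N t0 ->
  (forall n (t : T n), Q n t -> exists t' : T n.+1, P n t t' /\ Q n.+1 t') ->
  exists t : forall n, T n, t 0%N = t0 /\ forall n, P n (t n) (t n.+1).
Proof.
move=> Q0 step.
pose next n (t : {t | Q n t}) := cid (step n (sval t) (svalP t)).
pose fix t n : {t | Q n t} := if n is n.+1
  then exist (Q n.+1) (sval (next n (t n))) (svalP (next n (t n))).2
  else exist (Q 0%N) t0 Q0.
exists (fun n => sval (t n)); split=> // n.
exact: (svalP (next n (t n))).1.
Qed.

Section AugmentedResolution.
Variables (X : topologicalType) (F : sheaf X) (R : injective_resolution F).

(** With [F] in degree 0 all terms shift by one, and the augmentation becomes an ordinary
    differential in the inductions. *)
Definition aug_term (n : nat) : sheaf X := if n is n.+1 then res_term R n else F.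

Definition aug_diff (n : nat) : sheaf_mor (aug_term n) (aug_term n.+1) :=
  if n is n.+1 then res_diff R n else res_aug R.

Lemma aug_exact n : exact_at (aug_diff n) (aug_diff n.+1).
Proof. by case: n => [|n]; [exact: res_exact0|exact: res_exactS]. Qed.

Lemma aug_diff_comp n U a : aug_diff n.+1 U (aug_diff n U a) = 0.
Proof. exact: exact_comp0 (@aug_exact n) _ _. Qed.

End AugmentedResolution.

Section Comparison.
Variables (X : topologicalType) (F : sheaf X).
Implicit Types R S : injective_resolution F.

(** The invariant is that the map followed by the differential of [S] kills the kernel of the
    differential of [R]. Injectivity of the next term of [S] then extends this composite along the
    differential of [R]. *)
Lemma resolution_lift R S : exists phi : forall n,
    sheaf_mor (aug_term R n) (aug_term S n), phi 0%N = mor_id F /\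
    forall n U a, aug_diff S n U (phi n U a) = phi n.+1 U (aug_diff R n U a).
Proof.
apply: (@nat_dependent_choice (fun n => sheaf_mor (aug_term R n) (aug_term S n))
  (fun n f f' => forall U a, aug_diff S n U (f U a) = f' U (aug_diff R n U a))
  (fun n f => forall U b, aug_diff R n U b = 0 -> aug_diff S n U (f U b) = 0)).
  move=> U b; rewrite -(raddf0 (aug_diff R 0 U)) => /res_aug_inj ->.
  by rewrite !raddf0.
move=> n f f0.
have [f' f'E] := injective_extension (m := mor_comp (aug_diff S n) f)
  (@res_injective _ _ S n) f0.
exists f'; split=> [U a|U b]; first by rewrite f'E.
apply: (exact_kernel (m := mor_comp (aug_diff S n.+1) f') (@aug_exact _ _ R n)).
by move=> V a; rewrite [LHS]/= f'E /= aug_diff_comp.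
Qed.

(** The homotopy starts with the zero map into [F], consistent with [chi 0] being zero. At each
    stage [chi] minus d h vanishes on boundaries, hence on the kernel of the next differential by
    exactness, and so extends along it. *)
Lemma resolution_homotopy R (chi : forall n, sheaf_mor (aug_term R n) (aug_term R n)) :
  (forall U a, chi 0%N U a = 0) ->
  (forall n U a, aug_diff R n U (chi n U a) = chi n.+1 U (aug_diff R n U a)) ->
  exists h : forall n, sheaf_mor (aug_term R n.+1) (aug_term R n), forall n U b,
    chi n.+1 U b = aug_diff R n U (h n U b) + h n.+1 U (aug_diff R n.+1 U b).
Proof.
move=> chi0 chid.
have [|n h h0|h [_ hE]] := @nat_dependent_choice
  (fun n => sheaf_mor (aug_term R n.+1) (aug_term R n))
  (fun n h h' => forall U b,
    chi n.+1 U b = aug_diff R n U (h U b) + h' U (aug_diff R n.+1 U b))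
  (fun n h => forall U a, chi n.+1 U (aug_diff R n U a)
    - aug_diff R n U (h U (aug_diff R n U a)) = 0) (mor0 _ _).
- by move=> U a; rewrite -chid chi0 /= raddf0 !subr0.
- pose m := mor_sub (chi n.+1) (mor_comp (aug_diff R n) h).
  have [h' h'E] := injective_extension (m := m) (@res_injective _ _ R n)
    (exact_kernel (m := m) (@aug_exact _ _ R n) h0).
  exists h'; split=> [U b|U a]; first by rewrite h'E /= addrC subrK.
  by rewrite -chid h'E /= raddfB aug_diff_comp subr0 subrr.
- by exists h.
Qed.

(* [R] and [S] are homotopy equivalent, through lifts of the identity of [F]. *)
Lemma resolution_exact_sections R S (U : opens X) (n : nat) :
  (forall y, res_diff S n.+1 U y = 0 -> exists z, res_diff S n U z = y) ->
  forall x, res_diff R n.+1 U x = 0 -> exists z, res_diff R n U z = x.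
Proof.
move=> Sex x dx0.
have [phi [phi0 phid]] := resolution_lift R S.
have [psi [psi0 psid]] := resolution_lift S R.
pose chi k := mor_sub (mor_comp (psi k) (phi k)) (mor_id (aug_term R k)).
have [||h hE] := @resolution_homotopy R chi.
- by move=> V a; rewrite /= phi0 psi0 /= subrr.
- by move=> k V a; rewrite /= raddfB psid phid.
have [z dz] : exists z, res_diff S n U z = phi n.+2 U x.
  apply: Sex; have := phid n.+2 U x.
  by rewrite [aug_diff S _]/= => ->; rewrite [aug_diff R _]/= dx0 raddf0.
(* From psi phi - 1 = d h + h d and d x = 0 one gets psi (phi x) = x + d (h x); since phi x = d z, x
   = d (psi z - h x). Indices are shifted by the augmentation. *)
exists (psi n.+1 U z - h n.+1 U x); rewrite raddfB.
have := psid n.+1 U z; rewrite [aug_diff R _]/= => ->.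
rewrite [aug_diff S _]/= dz; have := hE n.+1 U x.
rewrite [aug_diff R n.+2]/= dx0 raddf0 addr0 [aug_diff R _]/= => <-.
by rewrite /= opprB addrC subrK.
Qed.

Lemma cohomology_vanishes_of_resolution (S : injective_resolution F) (j : nat) :
  (forall y, res_diff S j.+1 opensT y = 0 -> exists z, res_diff S j opensT z = y) ->
  sheaf_cohomology_vanishes F j.+1.
Proof.
move=> Sex; split=> [|R]; first by constructor.
by apply/homology_eq0P; apply: resolution_exact_sections Sex.
Qed.

End Comparison.

(** * Pushforward along a map with a retraction *)

Section PushforwardMorphisms.
Variables (X Y : topologicalType) (f : X -> Y) (fc : continuous f).

Fact pushforward_mor_natural (F G : sheaf X) (a : sheaf_mor F G) (U V : opens Y)
    (VU : V `<=` U) (s : pushforward fc F U) :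
  a (opens_preimage fc V) (restr (pushforward fc F) VU s) =
  restr (pushforward fc G) VU (a (opens_preimage fc U) s).
Proof. exact: mor_nat. Qed.

Definition pushforward_mor (F G : sheaf X) (a : sheaf_mor F G) :
    sheaf_mor (pushforward fc F) (pushforward fc G) :=
  @SheafMor Y (pushforward fc F) (pushforward fc G)
    (fun U => a (opens_preimage fc U)) (pushforward_mor_natural a).

(** The pushforward is the product of skyscrapers at the points [f (p i)]: the section groups are
    convertible and the restrictions differ only in membership proofs. *)
Lemma pushforward_sky_injective (I : Type) (p : I -> X) :
  injective_sheaf (pushforward fc (sky p)).
Proof.
pose to U : {additive pushforward fc (sky p) U -> sky (f \o p) U} := idfun.
pose from U : {additive sky (f \o p) U -> pushforward fc (sky p) U} := idfun.
have to_nat (U V : opens Y) (VU : V `<=` U) s :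
    to V (restr (pushforward fc (sky p)) VU s) = restr (sky (f \o p)) VU (to U s).
  by apply/funext => -[i Vi]; exact: (sky_section_irrel (s : sky p (opens_preimage fc U))).
have from_nat (U V : opens Y) (VU : V `<=` U) s :
    from V (restr (sky (f \o p)) VU s) = restr (pushforward fc (sky p)) VU (from U s).
  by apply/funext => -[i Vi]; exact: (sky_section_irrel (s : sky p (opens_preimage fc U))).
exact: (injective_retract (a := SheafMor to_nat) (b := SheafMor from_nat)
  (fun _ _ => erefl) (@sky_injective Y I (f \o p))).
Qed.

(* The hypotheses say that the stalk of a pushforward at [y] is the stalk of
   the original sheaf at [r y]. *)
Section Exactness.
Variable r : Y -> X.
Hypothesis fr_specializes : forall (V : opens Y) y, opens_set V y -> opens_set V (f (r y)).
Hypothesis r_nbhs : forall (N : opens X) y, opens_set N (r y) ->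
  exists W : opens Y, opens_set W y /\ f @^-1` W `<=` N.

(** To lift near a point [y] of [U], lift near [r y], which lies in the preimage of [U]; that
    neighbourhood contains the preimage of a neighbourhood of [y]. *)
Lemma pushforward_exact (F G H : sheaf X) (a : sheaf_mor F G) (b : sheaf_mor G H) :
  exact_at a b -> exact_at (pushforward_mor a) (pushforward_mor b).
Proof.
move=> ab U s; split=> [im|].
  apply/(ab (opens_preimage fc U) s) => x Ux; have [V [VU [Vx [t e]]]] := im _ Ux.
  by exists (opens_preimage fc V); eexists; split=> //; exists t; exact: e.
move=> /(ab (opens_preimage fc U) s) im y Uy.
have [N [NU [Ny [t e]]]] := im _ (fr_specializes Uy).
have [W0 [W0y W0N]] := r_nbhs Ny.
pose W := opensI U W0; have WN : opens_preimage fc W `<=` N.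
  by move=> x [_ W0x]; apply: W0N.
exists W, (@subIsetl _ _ _); split=> //; exists (restr F WN t).
by rewrite /= mor_nat e; apply: restr_comp.
Qed.

Definition pushforward_sky_resolution (F : sheaf X) :
    injective_resolution (pushforward fc F) :=
  @InjectiveResolution Y (pushforward fc F)
    (fun n => pushforward fc (sky_term F n))
    (pushforward_mor (sky_aug F))
    (fun n => pushforward_mor (sky_diff F n))
    (fun n => @pushforward_sky_injective _ _)
    (fun U => @sky_aug_inj X F (opens_preimage fc U))
    (pushforward_exact (@sky_exact0 X F))
    (fun n => pushforward_exact (@sky_exactS X F n)).

End Exactness.
End PushforwardMorphisms.

(** A local lift at [m] is already global, and on an empty space every section is zero. Assuming
    [setT] included in [U] lets [U] be the preimage of [opensT], which is not literally [opensT]. *)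
Lemma exact_sections_local (X : topologicalType) :
  (exists m : X, forall U : opens X, opens_set U m -> setT `<=` U) \/ (X -> False) ->
  forall (F G H : sheaf X) (f : sheaf_mor F G) (g : sheaf_mor G H), exact_at f g ->
  forall U : opens X, setT `<=` U ->
  forall s, g U s = 0 -> exists t, f U t = s.
Proof.
move=> localX F G H f g fg U UT s /fg im; case: localX => [[m mX]|noX].
  have [V [VU [Vm [t ft]]]] := im m (UT m Logic.I).
  have UV : U `<=` V := fun x _ => mX V Vm x Logic.I.
  exists (restr F UV t); rewrite mor_nat ft (restr_comp VU UV (@subset_refl _ _)).
  exact: restr_id.
exists 0; rewrite raddf0; apply/esym/section_locally0 => x.
by case: (noX x).
Qed.

(** * Spectra of a binoid and of its algebra *)

Section SpecRetraction.
Variables (K : fieldType) (M : binoidType).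
Hypotheses (Mtf : torsion_free M) (Mc : cancellative M).

Local Notation i := (@spec_embedding K M Mtf Mc).

Definition monomial_set (P : ring_spec (binoid_alg K M)) : set M :=
  [set mu | rprime P (binoid_T K mu)].

Fact monomial_set_prime P : binoid_prime (monomial_set P).
Proof.
have [P0 _ PM P1 PP] := rprimeP P; split.
- split; first by rewrite /monomial_set /= binoid_T_infty.
  by move=> a x Px; rewrite /monomial_set /= binoid_TD; apply: PM.
- by move=> PT; apply: P1; rewrite -binoid_T0; have : monomial_set P 0 by rewrite PT.
- by move=> a b; rewrite /monomial_set /= binoid_TD; apply: PP.
Qed.

Definition spec_retraction (P : ring_spec (binoid_alg K M)) : binoid_spec M :=
  BinoidSpec (monomial_set_prime P).

Lemma spec_embedding_retraction_sub P :
  rprime (i (spec_retraction P)) `<=` rprime P.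
Proof.
move=> f; have [P0 PD PM _ _] := rprimeP P.
elim/span_ind: f / => [//|a mu f Pmu Pf]; apply: PD => //.
by rewrite -[binoid_T K mu]mul1r -binoid_algZl; apply: PM.
Qed.

(** The ideal spanned by the monomials of [P] is contained in [P], and open sets are stable under
    passing to smaller primes. *)
Lemma spec_embedding_specializes (V : opens (ring_spec (binoid_alg K M))) P :
  opens_set V P -> opens_set V (i (spec_retraction P)).
Proof.
move=> VP; have := opensP V; rewrite ring_spec_openE => /(_ P VP)[f fP fV].
by apply: fV => /spec_embedding_retraction_sub.
Qed.

Lemma ring_basic_open_open (R : comPzRingType) (f : R) : open (ring_basic_open f).
Proof. by rewrite ring_spec_openE => P fP; exists f. Qed.

(** Around [spec_retraction P] there is a basic open D(mu) inside [N]; then D(T^mu) contains [P] and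
    pulls back into D(mu). *)
Lemma spec_retraction_nbhs (N : opens (binoid_spec M)) P :
  opens_set N (spec_retraction P) ->
  exists W : opens (ring_spec (binoid_alg K M)), opens_set W P /\ i @^-1` W `<=` N.
Proof.
move=> NP; have := opensP N; rewrite binoid_spec_openE => /(_ _ NP)[mu muP muN].
exists (Opens (@ring_basic_open_open _ (binoid_T K mu))); split=> // q iq.
apply: muN => qmu; apply: iq; rewrite -[binoid_T K mu]scale1r.
exact: spanZT.
Qed.

End SpecRetraction.

Definition nonunits (M : binoidType) : set M := [set x | forall y, x + y <> 0].

Fact nonunits_prime (M : binoidType) : infty <> 0 :> M -> binoid_prime (@nonunits M).
Proof.
move=> inf0; split.
- split; first by move=> y; rewrite addrC addr_infty.
  by move=> a x nx y; rewrite [a + x]addrC -addrA; apply: nx.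
- move=> nT; have /(_ 0) : @nonunits M 0 by rewrite nT.
  by rewrite addr0.
- move=> a b nab; apply: contrapT => /not_orP[/existsNP[x /contrapT ax]].
  move=> /existsNP[y /contrapT bby].
  by apply: (nab (x + y)); rewrite addrACA ax bby addr0.
Qed.

(** If D(f) contains the ideal of nonunits, then [f] is a unit and lies in no prime, so D(f) is
    everything. When [infty] is 0 there are no primes at all. *)
Lemma binoid_spec_local (M : binoidType) :
  (exists m : binoid_spec M, forall U : opens (binoid_spec M),
     opens_set U m -> setT `<=` U) \/ (binoid_spec M -> False).
Proof.
have [inf0|inf0] := eqVneq (infty : M) 0.
  by right=> p; have [[+ _] _ _] := bprimeP p; rewrite inf0; apply: bprime0.
left; exists (BinoidSpec (nonunits_prime (elimN eqP inf0))) => U.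
have := opensP U; rewrite binoid_spec_openE => oU /oU[f /existsNP[g /contrapT fg] fU] p _.
by apply: fU => pf; apply: (@bprime0 _ p); rewrite -fg; apply/bprimeD; left.
Qed.

Theorem proposition3p31 (K : fieldType) (M : binoidType)
    (Mfg : finitely_generated M) (Mtf : torsion_free M) (Mc : cancellative M)
    (F : sheaf (binoid_spec M)) (j : nat) (j1 : (1 <= j)%N) :
  sheaf_cohomology_vanishes
    (pushforward (@spec_embedding_continuous K M Mtf Mc) F) j.
Proof.
case: j j1 => [//|j] _; set ic := @spec_embedding_continuous K M Mtf Mc.
pose S := pushforward_sky_resolution ic (@spec_embedding_specializes K M Mtf Mc)
  (@spec_retraction_nbhs K M Mtf Mc) F.
apply: (cohomology_vanishes_of_resolution (S := S)).
(* Global sections of the pushed-forward resolution are sections of the skyscraper resolution of [F]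
   over all of Spec M, where exactness is global. *)
exact: (exact_sections_local (binoid_spec_local M) (sky_exactS (F := F) (n := j))
  (U := opens_preimage ic opensT) (fun _ _ => Logic.I)).
Qed.
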